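(* Let $A=\{a_k\}_{k\in\mathbb{Z}}$ be a sequence of complex numbers with $a_k=o(k^{\alpha})$ as $k\to\pm\infty$ for some $\alpha<1$. Let $p\ge 1$ and $n\ge 0$ be integers. If $|s-n|<1$ with $s\ne n$, then $$\frac{\Psi^{(p-1)}(-s;A)}{(p-1)!}=\frac{1}{(s-n)^p}\left\{a_n-\sum_{j=1}^\infty (-1)^j\binom{j+p-2}{p-1}M^{(A)}_n(j+p-1)(s-n)^{j+p-1}\right\}.$$
   Context: The growth condition $a_k=o(k^\alpha)$ is understood with $|k|^\alpha$ for negative $k$. Parametric digamma function: for $s\in\mathbb{C}\setminus\{0,1,2,\dots\}$, $$\Psi(-s;A):=\frac{a_0}{s}+\sum_{k=1}^\infty\left(\frac{a_k}{k}-\frac{a_k}{k-s}\right).$$ $\Psi^{(p-1)}(-s;A)$ denotes the $(p-1)$-th derivative of the function $z\mapsto\Psi(z;A)$ evaluated at $z=-s$. For integers $j\ge1$, $n\ge0$: $E^{(A)}_n(j):=\sum_{k=1}^n \frac{a_{n-k}}{k^j}$, $E^{(A)}_0(j):=0$; $F^{(A)}_n(1):=\sum_{k=1}^\infty\frac{a_{k+n}-a_k}{k}$ and $F^{(A)}_n(j):=\sum_{k=1}^\infty\frac{a_{k+n}}{k^j}$ for $j>1$; $M^{(A)}_n(j):=E^{(A)}_n(j)+(-1)^jF^{(A)}_n(j)$. *)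

(* Defs.v *)
From HB Require Import structures.
From mathcomp Require Export all_boot all_order all_algebra.
From mathcomp Require Export complex.
From mathcomp Require Export all_classical all_reals all_analysis.

Set Implicit Arguments.
Unset Strict Implicit.
Unset Printing Implicit Defensive.
Export Order.TTheory GRing.Theory Num.Theory.
Export numFieldNormedType.Exports.

Local Open Scope classical_set_scope.
Local Open Scope ring_scope.

(* R[i] packaged as a numFieldType: topology, norm, limits and the (complex)
   derivative are then those the library attaches to any numFieldType. *)
Definition Cplx (R : realType) : numFieldType := R[i].

Section ParametricDigamma.
Context {R : realType}.
Local Notation C := (Cplx R).

(* Infinite sums start at 1 and are limits of partial sums, hence possibly only
   conditionally convergent; this matters for F_n(1).  [sum1 u] is meaningful
   only when [sum1_cvg u] holds. *)
Definition partial_sum1 (u : nat -> C) (N : nat) : C :=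
  \sum_(1 <= k < N.+1) u k.

Definition sum1_cvg (u : nat -> C) : Prop := cvgn (partial_sum1 u).

Definition sum1 (u : nat -> C) : C := limn (partial_sum1 u).

(* a_k = o(|k|^alpha) as k -> +oo and as k -> -oo. *)
Definition is_littleo_pow (a : int -> C) (alpha : R) : Prop :=
  (fun k : nat => a k%:Z) =o_\oo (fun k : nat => (k%:R `^ alpha)%:C%C : C) /\
  (fun k : nat => a (- k%:Z)) =o_\oo (fun k : nat => (k%:R `^ alpha)%:C%C : C).

Variable a : int -> C.

Definition Psi_term (s : C) (k : nat) : C :=
  a k%:Z / k%:R - a k%:Z / (k%:R - s).

(* The variable is z = -s, so that derivatives are taken with respect to z.
   At the poles z = 0, -1, -2, ... the value is a convention (x / 0 = 0). *)
Definition Psi (z : C) : C := let s := - z in a 0 / s + sum1 (Psi_term s).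

Definition E (n j : nat) : C :=
  \sum_(1 <= k < n.+1) a (n%:Z - k%:Z) / k%:R ^+ j.

Definition F_term (n j k : nat) : C :=
  if j == 1%N then (a (k%:Z + n%:Z) - a k%:Z) / k%:R
  else a (k%:Z + n%:Z) / k%:R ^+ j.

Definition F (n j : nat) : C := sum1 (F_term n j).

Definition M (n j : nat) : C := E n j + (-1) ^+ j * F n j.

End ParametricDigamma.

(* Main.v *)
Require Import Defs.
From mathcomp Require Import ring lra zify.

(* Put v = n - s, so that z = -s satisfies z + n = v and 0 < |v| < 1.  Expanding
   each 1 / (k - s) as a geometric series in v yields the Laurent expansion
   Psi(z) = - a_n / v + sum_(j >= 0) M_n(j + 1) v^j.  The exchange of sums is done
   by telescoping the remainders of the finite geometric expansions: after the
   first term they are dominated by |v|^J times sum_k |a_(k+n)| / k^2, which is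
   finite because alpha < 1.  The conditionally convergent sum F_n(1) comes from
   the telescoping of a_(k+n) / (k+n) - a_k / k, whose sum is finite since
   a_k / k -> 0.  The power series converges on the unit disk, so it is
   differentiated termwise p - 1 times. *)

Set Implicit Arguments.
Unset Strict Implicit.
Unset Printing Implicit Defensive.

Local Open Scope classical_set_scope.
Local Open Scope ring_scope.

(** * Real-valued modulus, and reduction of complex limits to real ones *)

Section ComplexNorm.
Context {R : realType}.
Implicit Types (x y z : Cplx R) (r : R).

(** The norm on [Cplx R] takes values in the complex numbers; its real part gives access to the
    total order on [R] and to real comparison arguments. *)
Definition normR z : R := complex.Re (`|z| : R[i]).

Lemma normRE z : `|z| = (normR z)%:C%C :> Cplx R.
Proof. by rewrite /normR (RRe_real (normr_real (z : R[i]))). Qed.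

Lemma normR_ge0 z : 0 <= normR z.
Proof. by rewrite -ler0c -normRE; exact: (normr_ge0 (z : R[i])). Qed.

Lemma normR0 : normR 0 = 0.
Proof. by rewrite /normR (normr0 (R[i])). Qed.

Lemma normR_nat n : normR n%:R = n%:R.
Proof. by apply: (@complexI R); rewrite -normRE normr_nat rmorph_nat. Qed.

Lemma normRM : {morph normR : x y / x * y}.
Proof.
by move=> x y; apply: (@complexI R); rewrite -normRE normrM !normRE rmorphM.
Qed.

Lemma normRV : {morph normR : x / x^-1}.
Proof.
by move=> x; apply: (@complexI R); rewrite -normRE normfV normRE fmorphV.
Qed.

Lemma normRX n : {morph normR : x / x ^+ n}.
Proof.
by move=> x; apply: (@complexI R); rewrite -normRE normrX normRE rmorphXn.
Qed.

Lemma normRN x : normR (- x) = normR x.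
Proof. by apply: (@complexI R); rewrite -!normRE normrN. Qed.

Lemma ler_normRD x y : normR (x + y) <= normR x + normR y.
Proof. by rewrite -lecR rmorphD /= -!normRE; exact: (ler_normD (x : R[i]) y). Qed.

Lemma ler_normRB x y : normR x - normR y <= normR (x + y).
Proof.
rewrite lerBlDr -(normRN y); apply: le_trans (ler_normRD _ _).
by rewrite addrK.
Qed.

Lemma ler_normR_sum I (s : seq I) (P : pred I) (f : I -> Cplx R) :
  normR (\sum_(i <- s | P i) f i) <= \sum_(i <- s | P i) normR (f i).
Proof.
elim/big_rec2: _ => [|i r x _ h]; first by rewrite normR0.
by apply: le_trans (ler_normRD _ _) _; rewrite lerD2l.
Qed.

Lemma normR_eq0 x : (normR x == 0) = (x == 0).
Proof. by rewrite -(inj_eq (@complexI R)) -normRE normr_eq0. Qed.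

Lemma normR_gt0 x : (0 < normR x) = (x != 0).
Proof. by rewrite lt_neqAle normR_ge0 andbT eq_sym normR_eq0. Qed.

Lemma normR_lt x r : (`|x| < (r%:C%C : Cplx R)) = (normR x < r).
Proof. by rewrite normRE; exact: ltcR. Qed.

Lemma normR_lt1 x : (`|x| < 1) = (normR x < 1).
Proof. exact: (normR_lt x 1). Qed.

Lemma normR_real r : 0 <= r -> normR (r%:C%C) = r.
Proof.
by move=> r0; rewrite /normR ger0_norm//; exact: (etrans (ler0c _) r0).
Qed.

Lemma gt0_complexE (e : Cplx R) : 0 < e -> exists2 r, 0 < r & e = r%:C%C.
Proof.
move=> e0; exists (normR e); first by rewrite normR_gt0 gt_eqF.
by rewrite -normRE gtr0_norm.
Qed.

Lemma cvgCP {T} {F : set_system T} {FF : Filter F} (f : T -> Cplx R) (l : Cplx R) :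
  f @ F --> l <-> normR (l - f t) @[t --> F] --> (0 : R).
Proof.
split=> [/cvgrPdist_lt h|/cvgr0Pnorm_lt h].
- apply/cvgr0Pnorm_lt => e e0.
  have /h : (0 : Cplx R) < e%:C%C by exact: (etrans (ltcR _ _) e0).
  by apply: filterS => t; rewrite normR_lt ger0_norm ?normR_ge0.
- apply/cvgrPdist_lt => _ /gt0_complexE[e e0 ->].
  have := h e e0; apply: filterS => t.
  by rewrite ger0_norm ?normR_ge0// normR_lt.
Qed.

Lemma cvgC_squeeze {T} {F : set_system T} {FF : Filter F} (f : T -> Cplx R)
    (l : Cplx R) (g : T -> R) :
  (\forall t \near F, normR (l - f t) <= g t) -> g @ F --> (0 : R) -> f @ F --> l.
Proof.
move=> fg g0; apply/cvgCP; apply: (squeeze_cvgr _ (cvg_cst 0) g0).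
by apply: filterS fg => t; rewrite normR_ge0.
Qed.

Lemma normR_Re x : `|complex.Re x| <= normR x.
Proof. by rewrite -lecR -normRE; exact: (normc_ge_Re (x : R[i])). Qed.

Lemma normR_Im x : `|complex.Im x| <= normR x.
Proof.
have -> : normR x = Num.sqrt (complex.Re x ^+ 2 + complex.Im x ^+ 2).
  by rewrite /normR normc_def.
by rewrite -sqrtr_sqr ler_wsqrtr// lerDr sqr_ge0.
Qed.

Lemma normR_complex (u v : R) : normR (u +i* v)%C <= `|u| + `|v|.
Proof.
rewrite /normR normc_def /= -[leRHS]ger0_norm ?addr_ge0// -sqrtr_sqr.
rewrite ler_wsqrtr// sqrrD !real_normK ?num_real// lerD2r lerDl.
by rewrite mulrn_wge0// mulr_ge0.
Qed.

End ComplexNorm.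

(** * Comparison tests for complex series *)

Section DominatedSeries.
Context {R : realType}.
Implicit Types (u : nat -> Cplx R) (v : nat -> R).

(** Both series are cut off below the rank where the bound starts; the partial sums of [v] are then
    monotone and bounded by those of [w]. *)
Lemma series_le_cvg_near v w : (forall n, 0 <= v n) ->
  (\forall n \near \oo, v n <= w n) -> cvgn (series w) -> cvgn (series v).
Proof.
move=> v0 [N _ vw] cw; rewrite -(@is_cvg_series_restrict N).
move: cw; rewrite -(@is_cvg_series_restrict N).
move=> /cvg_seq_bounded/bounded_fun_has_ubound[M wM].
apply: nondecreasing_is_cvgn; first exact: nondecreasing_series.
exists M => _ [n _ <-]; apply: le_trans (wM _ _); last by exists n.
by apply: ler_sum_nat => i /andP[/vw].
Qed.

Lemma Re_sum (s : seq nat) u :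
  complex.Re (\sum_(i <- s) u i) = \sum_(i <- s) complex.Re (u i).
Proof. exact: (raddf_sum (@complex.Re R)). Qed.

Lemma Im_sum (s : seq nat) u :
  complex.Im (\sum_(i <- s) u i) = \sum_(i <- s) complex.Im (u i).
Proof. exact: (raddf_sum (@complex.Im R)). Qed.

(** The real and imaginary parts converge absolutely by comparison, and their limits assemble into
    the complex one. *)
Lemma dominated_series_cvg u v : (\forall n \near \oo, normR (u n) <= v n) ->
  cvgn (series v) -> cvgn (series u).
Proof.
move=> uv cv.
have cre : cvgn (series (fun k => complex.Re (u k))).
  apply: normed_cvg; apply: series_le_cvg_near _ _ cv => [n|] /=; first exact: normr_ge0.
  by apply: filterS uv => n; apply: le_trans; exact: normR_Re.
have cim : cvgn (series (fun k => complex.Im (u k))).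
  apply: normed_cvg; apply: series_le_cvg_near _ _ cv => [n|] /=; first exact: normr_ge0.
  by apply: filterS uv => n; apply: le_trans; exact: normR_Im.
set lr := limn (series (fun k => complex.Re (u k))) in cre.
set li := limn (series (fun k => complex.Im (u k))) in cim.
apply/cvg_ex; exists (lr +i* li)%C.
apply: (@cvgC_squeeze _ _ _ _ _ _ (fun n =>
  `|lr - series (fun k => complex.Re (u k)) n|
  + `|li - series (fun k => complex.Im (u k)) n|)).
  near=> n; apply: le_trans (normR_complex _ _).
  have -> : series u n = (series (fun k => complex.Re (u k)) n +i*
     series (fun k => complex.Im (u k)) n)%C.
    by rewrite /series /= -Re_sum -Im_sum; case: (\sum_(0 <= k < n) u k).
  by [].
rewrite -[X in _ --> X](addr0 0); apply: cvgD; apply/norm_cvg0P.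
  by rewrite -[X in _ --> X](subrr lr); apply: cvgB => //; exact: cvg_cst.
by rewrite -[X in _ --> X](subrr li); apply: cvgB => //; exact: cvg_cst.
Unshelve. all: by end_near. Qed.

Lemma dominated_series_norm u v : (forall n, normR (u n) <= v n) ->
  cvgn (series v) -> normR (limn (series u)) <= limn (series v).
Proof.
move=> uv cv; have cu : cvgn (series u).
  by apply: dominated_series_cvg cv; near=> n.
apply/ler_addgt0Pr => e e0.
move/cvgCP/cvgr0Pnorm_lt : cu => /(_ e e0)[N _ /(_ N (leqnn N))].
rewrite ger0_norm ?normR_ge0// => uN.
rewrite -[limn _](subrK (series u N)) addrC (le_trans (ler_normRD _ _))//.
rewrite lerD ?(ltW uN)//.
rewrite (le_trans (ler_normR_sum _ _ _))//.
apply: (@le_trans _ _ (series v N)); first exact: ler_sum.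
apply: (nondecreasing_cvgn_le _ cv).
by apply: nondecreasing_series => i _ _; apply: le_trans (uv _); rewrite normR_ge0.
Unshelve. all: by end_near. Qed.

End DominatedSeries.

(** * Power series on the unit disk and termwise differentiation *)

Section PowerSeries.
Context {R : realType}.
Local Notation C := (Cplx R).
Implicit Types (c : nat -> C) (d : nat -> R).

Definition psum c (w : C) : C := limn (series (fun j => c j * w ^+ j)).

Definition conv_disk c :=
  forall w : C, `|w| < 1 -> cvgn (series (fun j => c j * w ^+ j)).

Definition psum_diffs c (j : nat) : C := j.+1%:R * c j.+1.

(** Abel's lemma: convergence at the midpoint [r'] of [r] and 1 makes the terms there eventually
    smaller than 1, so at [r] they are dominated by a geometric series of ratio [r / r']. *)
Lemma conv_disk_abs c : conv_disk c ->
  forall r : R, 0 <= r < 1 -> cvgn (series (fun j => normR (c j) * r ^+ j)).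
Proof.
move=> hc r /andP[r0 r1]; pose r' := (1 + r) / 2.
have r'0 : 0 < r' by rewrite /r'; lra.
have r'1 : `|(r'%:C%C : C)| < 1.
  by rewrite normR_lt1 normR_real ?(ltW r'0)// /r'; lra.
have /cvg_series_cvg_0/cvgr0Pnorm_lt/(_ 1 ltr01) b := hc _ r'1.
apply: (series_le_cvg_near (w := geometric 1 (r / r'))) => [n||].
- by rewrite mulr_ge0 ?normR_ge0 ?exprn_ge0.
- apply: filterS b => n; rewrite normR_lt1 normRM normRX normR_real ?(ltW r'0)//.
  move=> h; rewrite /= mul1r expr_div_n mulrC ler_wpM2l ?exprn_ge0//.
  by rewrite -[leRHS]mul1r ler_pdivlMr ?exprn_gt0// ltW.
- apply: is_cvg_geometric_series.
  have rr' : 0 <= r / r' by rewrite divr_ge0// ltW.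
  by rewrite ger0_norm// ltr_pdivrMr// mul1r /r'; lra.
Qed.

(** Each of the [j] terms of the geometric sum is at least [rho ^+ j], and the sum is at most
    [(1 - rho)^-1]. *)
Lemma natr_geometric_le (rho : R) (j : nat) : 0 <= rho < 1 ->
  j%:R * rho ^+ j <= (1 - rho)^-1.
Proof.
move=> /andP[r0 r1]; have r'0 : 0 < 1 - rho by rewrite subr_gt0.
apply: (@le_trans _ _ (\sum_(i < j) rho ^+ i)).
  rewrite mulr_natl -[X in _ *+ X]card_ord -sumr_const ler_sum// => i _.
  by rewrite ler_wiXn2l ?(ltW r1)// ltnW.
have := subrX1 rho j; rewrite -opprB -[in RHS]opprB mulNr => /oppr_inj h.
rewrite -[leRHS]mul1r ler_pdivlMr// mulrC -h lerBlDr lerDl exprn_ge0//.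
Qed.

(** The factor [j] is absorbed by enlarging the radius from [r] to the midpoint [r'] of [r] and 1,
    since [j (r / r')^j] stays bounded. *)
Lemma cvg_natr_abs d : (forall j, 0 <= d j) ->
  (forall r : R, 0 <= r < 1 -> cvgn (series (fun j => d j * r ^+ j))) ->
  forall r : R, 0 <= r < 1 -> cvgn (series (fun j => (j%:R * d j) * r ^+ j)).
Proof.
move=> d0 hd r /andP[r0 r1]; pose r' := (1 + r) / 2.
have r'0 : 0 < r' by rewrite /r'; lra.
have rho0 : 0 <= r / r' < 1.
  by rewrite divr_ge0 ?(ltW r'0)//= ltr_pdivrMr// mul1r /r'; lra.
have r'1 : 0 <= r' < 1 by rewrite (ltW r'0) /r' /=; lra.
apply: (series_le_cvg_near (w := (1 - r / r')^-1 *: (fun j => d j * r' ^+ j))).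
- by move=> n; rewrite !mulr_ge0 ?exprn_ge0.
- apply: nearW => n; rewrite /= [leRHS]mulrC -[r in leLHS](divfK (lt0r_neq0 r'0)) exprMn.
  have := natr_geometric_le n rho0.
  set A := _ ^+ n; set B := (1 - _)^-1 => h.
  rewrite (_ : _ * _ = n%:R * A * (d n * r' ^+ n)); last by ring.
  rewrite [leRHS]mulrC ler_wpM2r// mulr_ge0// exprn_ge0// ltW//.
- by apply: is_cvg_seriesZ; exact: hd.
Qed.

Lemma psum_diffs_term c (w : C) :
  series (fun j => psum_diffs c j * w ^+ j) =
  (fun n => series (fun j => j%:R * c j * w ^+ j.-1) n.+1).
Proof.
apply/funext => n; rewrite /series /= [RHS]big_nat_recl//= !mul0r add0r.
by apply: eq_bigr.
Qed.

Lemma cvg_psum_diffs c (w : C) : conv_disk c -> `|w| < 1 ->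
  cvgn (series (fun j => j%:R * c j * w ^+ j.-1)).
Proof.
move=> hc; rewrite normR_lt1 => w1; pose r := (1 + normR w) / 2.
have w0 := normR_ge0 w.
have r0 : 0 < r by rewrite /r; lra.
have r1 : 0 <= r < 1 by rewrite (ltW r0) /r /=; lra.
(* The factor [r^-1] makes up for the lowered exponent. At [j = 0] the truncated predecessor leaves
   [w ^+ 0], and [r <= 1] settles the comparison. *)
apply: (dominated_series_cvg
    (v := r^-1 *: (fun j => (j%:R * normR (c j)) * r ^+ j))).
- apply: nearW => n; rewrite /= !normRM normRX normR_nat [leRHS]mulrCA ler_wpM2l//.
    by rewrite mulr_ge0// normR_ge0.
  case: n => [|n]; first by rewrite !expr0 mulr1 invf_ge1// /r; lra.
  rewrite exprS mulKf ?gt_eqF//= lerXn2r ?nnegrE ?normR_ge0 ?(ltW r0)//.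
  by rewrite /r; lra.
- apply: is_cvg_seriesZ.
  by apply: cvg_natr_abs r1 => [j|]; [exact: normR_ge0|exact: conv_disk_abs].
Qed.

Lemma conv_disk_diffs c : conv_disk c -> conv_disk (psum_diffs c).
Proof.
move=> hc w w1; rewrite psum_diffs_term.
have /cvg_ex[l] := cvg_psum_diffs hc w1; rewrite -cvg_shiftS => h.
by apply/cvg_ex; exists l.
Qed.

Lemma psum_diffsE c (w : C) : conv_disk c -> `|w| < 1 ->
  psum (psum_diffs c) w = limn (series (fun j => j%:R * c j * w ^+ j.-1)).
Proof.
move=> hc w1; have := cvg_psum_diffs hc w1.
rewrite -cvg_shiftS => h; rewrite /psum psum_diffs_term.
exact: cvg_lim h.
Qed.

(** With [T_j] the first-order Taylor remainder of the [j]-th power,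
    [T_(j+1) = u T_j + j w^(j-1) (u - w)^2], and induction applies. The factor [r ^+ 2] on the left
    avoids the exponent [j - 2] on the right. *)
Lemma expr_taylor1_le (r : R) (u w : C) (j : nat) :
  normR u <= r -> normR w <= r ->
  r ^+ 2 * normR (u ^+ j - w ^+ j - j%:R * w ^+ j.-1 * (u - w)) <=
  (j%:R * j%:R) * r ^+ j * normR (u - w) ^+ 2.
Proof.
move=> ur wr; have r0 : 0 <= r := le_trans (normR_ge0 _) ur.
elim: j => [|j IH].
  by rewrite !expr0 subrr !mul0r subrr normR0 mulr0.
have -> : u ^+ j.+1 - w ^+ j.+1 - j.+1%:R * w ^+ j.+1.-1 * (u - w) =
    u * (u ^+ j - w ^+ j - j%:R * w ^+ j.-1 * (u - w))
    + j%:R * w ^+ j.-1 * (u - w) ^+ 2.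
  by case: j {IH} => [|j] /=; rewrite !exprS; ring.
apply: (@le_trans _ _ (r * (j%:R * j%:R * r ^+ j * normR (u - w) ^+ 2)
   + j%:R * r ^+ j.+1 * normR (u - w) ^+ 2)).
  apply: (@le_trans _ _ (r ^+ 2 * (normR u *
     normR (u ^+ j - w ^+ j - j%:R * w ^+ j.-1 * (u - w)) +
     normR (j%:R * w ^+ j.-1 * (u - w) ^+ 2)))).
    by rewrite ler_wpM2l ?exprn_ge0// -normRM ler_normRD.
  rewrite mulrDr lerD//.
    rewrite mulrCA ler_pM ?normR_ge0// mulr_ge0 ?normR_ge0 ?exprn_ge0//.
  rewrite !normRM !normRX normR_nat mulrA.
  apply: ler_wpM2r; first by rewrite mulr_ge0 ?normR_ge0.
  case: j {IH} => [|j]; first by rewrite /= !mul0r mulr0.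
  rewrite mulrCA ler_wpM2l//= -(addn2 j) addnC exprD ler_wpM2l ?exprn_ge0//.
  by rewrite lerXn2r ?nnegrE ?normR_ge0.
rewrite -subr_ge0 (_ : _ - _ = (j%:R + 1) * r ^+ j.+1 * normR (u - w) ^+ 2).
  by rewrite !mulr_ge0 ?exprn_ge0 ?normR_ge0// addr_ge0.
by rewrite exprS; ring.
Qed.

Lemma limnC (u : nat -> C) (l : C) : u @ \oo --> l -> limn u = l.
Proof. exact: (@cvg_lim C (@norm_hausdorff C C)). Qed.

Lemma lim_series_slope (f g k : nat -> C) (t : C) :
  cvgn (series f) -> cvgn (series g) -> cvgn (series k) ->
  limn (series k) - t * (limn (series f) - limn (series g)) =
  limn (series (fun j => k j - t * (f j - g j))).
Proof.
move=> cf cg ck; symmetry; apply: limnC.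
rewrite (_ : series _ = fun n => series k n - t * (series f n - series g n)).
  apply: cvgB; first exact: ck.
  apply: cvgM; first exact: cvg_cst.
  by apply: cvgB; [exact: cf|exact: cg].
by apply/funext => n; rewrite /series /= sumrB -mulr_sumr sumrB.
Qed.

(* By [expr_taylor1_le], the difference quotient at [h] differs from the
   termwise derivative by at most [|h|] times a convergent sum. *)
Lemma is_derive_psum c (z b : C) : conv_disk c -> `|z + b| < 1 ->
  is_derive z 1 (fun x : C => psum c (x + b)) (psum (psum_diffs c) (z + b)).
Proof.
move=> hc; set w := z + b => w1.
pose r := (1 + normR w) / 2.
have w0 := normR_ge0 w; have w1' : normR w < 1 by rewrite -normR_lt1.
have r0 : 0 < r by rewrite /r; lra.
have r1 : 0 <= r < 1 by rewrite (ltW r0) /r /=; lra.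
(* The Taylor remainder costs a factor [j^2], so [cvg_natr_abs] is applied twice. *)
have cd : cvgn (series (fun j => (j%:R * (j%:R * normR (c j))) * r ^+ j)).
  have h1 := cvg_natr_abs (fun j => normR_ge0 (c j)) (conv_disk_abs hc).
  by apply: cvg_natr_abs h1 _ r1 => j; rewrite mulr_ge0 ?normR_ge0.
pose K := limn (series (fun j => (j%:R * (j%:R * normR (c j))) * r ^+ j)).
have main (h : C) : h != 0 -> normR h < (1 - normR w) / 2 ->
    normR (psum (psum_diffs c) w - h^-1 * (psum c (h *: 1 + z + b) - psum c w))
    <= K / r ^+ 2 * normR h.
  move=> h0 hh; have -> : h *: 1 + z + b = h + w by rewrite [h *: 1]mulr1 addrA.
  have hw : normR (h + w) < r.
    by apply: le_lt_trans (ler_normRD _ _) _; rewrite /r; lra.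
  have c1 : cvgn (series (fun j => c j * (h + w) ^+ j)).
    by apply: hc; rewrite normR_lt1; case/andP: r1 => _; exact: lt_trans.
  have c2 : cvgn (series (fun j => c j * w ^+ j)) by exact: hc.
  have c3 := cvg_psum_diffs hc w1.
  have -> : psum (psum_diffs c) w - h^-1 * (psum c (h + w) - psum c w) =
     limn (series (fun j => - (h^-1 * c j *
       ((h + w) ^+ j - w ^+ j - j%:R * w ^+ j.-1 * (h + w - w))))).
    rewrite (psum_diffsE hc w1); apply: (etrans (lim_series_slope h^-1 c1 c2 c3)).
    congr (limn (series _)); apply/funext => j.
    by field.
  rewrite (_ : K / r ^+ 2 * _ = limn (series ((r ^- 2 * normR h) *:
      (fun j => (j%:R * (j%:R * normR (c j))) * r ^+ j)))); last first.
    by rewrite lim_seriesZ// -mulrA [LHS]mulrC.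
  apply: dominated_series_norm; last exact: is_cvg_seriesZ.
  move=> j; rewrite normRN !normRM normRV /=.
  have wr : normR w <= r by rewrite /r; lra.
  have := expr_taylor1_le j (ltW hw) wr; rewrite addrK.
  set P := normR (_ - _); set Q := r ^+ j => PQ.
  have h0' : 0 < normR h by rewrite normR_gt0.
  rewrite [leRHS](_ : _ = (normR h)^-1 * normR (c j) *
    (r ^- 2 * (j%:R * j%:R * Q * normR h ^+ 2))); last first.
    transitivity ((r ^- 2 * normR h) * (j%:R * (j%:R * normR (c j)) * Q)) => //.
    by field; rewrite !gt_eqF.
  rewrite ler_wpM2l ?mulr_ge0 ?invr_ge0 ?normR_ge0//.
  by rewrite ler_pdivlMl// exprn_gt0.
have lm : h^-1 *: (psum c (h *: 1 + z + b) - psum c w) @[h --> (0:C)^'] -->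
    psum (psum_diffs c) w.
  apply: (cvgC_squeeze (g := fun h => K / r ^+ 2 * normR h)).
    have e0 : (0 : C) < ((1 - normR w) / 2)%:C%C.
      by apply: (etrans (ltcR _ _)); lra.
    near=> h; apply: main; first by near: h; exact: nbhs_dnbhs_neq.
    by rewrite -normR_lt; near: h; exact: dnbhs0_lt.
  rewrite -[X in _ --> X](mulr0 (K / r ^+ 2)).
  apply: cvgM; first exact: cvg_cst.
  have /cvgCP : -%R @ (0 : C)^' --> - (0 : C).
    by apply: cvgN; apply: cvg_within.
  by under eq_cvg do rewrite oppr0 sub0r opprK.
split; first by apply/cvg_ex; exists (psum (psum_diffs c) w).
exact: (@cvg_lim C (@norm_hausdorff C C)) lm.
Unshelve. all: by end_near. Qed.

End PowerSeries.

(** * Growth of the coefficients and their summability against inverse squares *)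

Section Growth.
Context {R : realType}.

(** After division by [(k+2)^(-g)] the claim is [1 + g / (k+2) <= ((k+2) / (k+1))^g]. It follows
    from [exp x >= 1 + x] and [ln (1 - 1/(k+2)) <= - 1/(k+2)]. *)
Lemma powR_telescope_le (g : R) (k : nat) : 0 < g ->
  g * k.+2%:R `^ (- g - 1) <= k.+1%:R `^ (- g) - k.+2%:R `^ (- g).
Proof.
move=> g0; have k1 : (0 : R) < k.+1%:R by [].
have k2 : (0 : R) < k.+2%:R by [].
rewrite powRD; last by apply/implyP => _; rewrite gt_eqF.
rewrite powR_inv1 ?(ltW k2)//.
have -> : k.+1%:R `^ (- g) = k.+2%:R `^ (- g) * (k.+2%:R / k.+1%:R) `^ g :> R.
  rewrite powRM ?invr_ge0// -[X in _ = _ * (_ * X `^ g)]powR_inv1// -powRrM.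
  by rewrite mulN1r [k.+2%:R `^ (- g)]powRN mulKf// gt_eqF// powR_gt0.
rewrite -[X in _ <= _ - X]mulr1 -mulrBr mulrCA ler_wpM2l ?powR_ge0//.
rewrite lerBrDr.
rewrite /powR gt_eqF ?divr_gt0//.
apply: le_trans (expR_ge1Dx _).
rewrite addrC lerD2l ler_wpM2l ?(ltW g0)//.
rewrite -[_ / _]invrK lnV ?posrE ?invr_gt0 ?divr_gt0// invf_div lerNr.
have -> : k.+1%:R / k.+2%:R = 1 + - k.+2%:R^-1 :> R.
  have e2 : k.+2%:R = k.+1%:R + 1 :> R by rewrite natr1.
  by rewrite -[X in X / _](addrK 1) -e2 mulrBl divff ?gt_eqF// mul1r.
apply: le_ln1Dx.
rewrite ltrN2 invf_lt1// ltr1n//.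
Qed.

(** The telescoping bound keeps all partial sums below [g^-1]. *)
Lemma cvg_series_powR (g : R) : 0 < g ->
  cvgn (series (fun k => k.+2%:R `^ (- g - 1))).
Proof.
move=> g0; apply: nondecreasing_is_cvgn.
  by apply: nondecreasing_series => n _ _; exact: powR_ge0.
exists g^-1 => _ [N _ <-].
rewrite -[leRHS]mul1r ler_pdivlMr// mulrC /series /= mulr_sumr.
apply: (@le_trans _ _ (\sum_(0 <= k < N) (k.+1%:R `^ (- g) - k.+2%:R `^ (- g)))).
  by apply: ler_sum => k _; exact: powR_telescope_le.
rewrite (@telescope_sumr_eq _ 0 N (fun k => - (k.+1%:R `^ (- g)))) //.
  by rewrite powR1 opprK addrC lerBlDr lerDl powR_ge0.
by move=> k _; rewrite opprK addrC.
Qed.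

Lemma littleo_pow_le (a : int -> Cplx R) (alpha : R) : is_littleo_pow a alpha ->
  forall e : R, 0 < e ->
  \forall k \near \oo, normR (a k%:Z) <= e * k%:R `^ alpha.
Proof.
move=> [/eqoP ha _] e e0.
have e0' : (0 : Cplx R) < e%:C%C by apply: (etrans (ltcR _ _)).
have := ha _ e0'; apply: filterS => k.
rewrite !normRE normR_real ?powR_ge0// -rmorphM.
by move=> h; rewrite -lecR.
Qed.

Variables (a : int -> Cplx R) (alpha : R).
Hypotheses (halpha : alpha < 1) (ha : is_littleo_pow a alpha).

Lemma littleo_pow_div_cvg0 : (fun k : nat => a k%:Z / k%:R) @ \oo --> (0 : Cplx R).
Proof.
apply/cvgCP/cvgr0Pnorm_le => e e0.
have := littleo_pow_le ha e0.
move=> /filterS2; apply; last by exact: (nbhs_infty_ge 1).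
move=> k ak k1; rewrite ger0_norm ?normR_ge0//.
have k0 : (0 : R) < k%:R by rewrite ltr0n.
rewrite sub0r normRN normRM normRV normR_nat ler_pdivrMr//.
apply: le_trans ak _; rewrite ler_wpM2l ?(ltW e0)//.
by rewrite -[leRHS]powRr1 ?(ltW k0)// ler_powR ?(ltW halpha)// ler1n.
Qed.

Lemma littleo_pow_summable (n : nat) :
  cvgn (series (fun k => normR (a (k + n)%N%:Z) / k.+2%:R ^+ 2)).
Proof.
(* A nonnegative exponent makes the power monotone in its base, so that the shift by [n] only costs
   a constant: [k + n <= (n+1)(k+2)] and [(n+1)^b <= n+1]. *)
pose b := Num.max alpha 0.
have b1 : b < 1 by rewrite /b gt_max halpha ltr01.
have b0 : 0 <= b by rewrite /b le_max lexx orbT.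
apply: (series_le_cvg_near (w := n.+1%:R *: (fun k => k.+2%:R `^ (- (1 - b) - 1)))).
- by move=> k; rewrite divr_ge0 ?normR_ge0 ?exprn_ge0.
- have [N _ hN] := littleo_pow_le ha ltr01.
  near=> k.
  have kN : (N <= k + n)%N by rewrite (leq_trans _ (leq_addr _ _))//; near: k; exact: nbhs_infty_ge.
  have k1 : (1 <= k + n)%N by rewrite (leq_trans _ (leq_addr _ _))//; near: k; exact: nbhs_infty_ge.
  have k2 : (0 : R) < k.+2%:R by [].
  rewrite ler_pdivrMr ?exprn_gt0//.
  apply: le_trans (hN _ kN) _; rewrite mul1r.
  apply: (@le_trans _ _ ((n.+1 * k.+2)%N%:R `^ b)).
    apply: (@le_trans _ _ ((k + n)%N%:R `^ b)).
      by rewrite ler_powR ?ler1n// /b le_max lexx.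
    rewrite ge0_ler_powR ?nnegrE// ler_nat; lia.
  rewrite natrM powRM//.
  have -> : k.+2%:R `^ b = k.+2%:R `^ (- (1 - b) - 1) * k.+2%:R ^+ 2 :> R.
    rewrite -powR_mulrn ?(ltW k2)// -powRD; last by apply/implyP => _; rewrite gt_eqF.
    by congr powR; ring.
  rewrite [leRHS](_ : _ = n.+1%:R * (k.+2%:R `^ (- (1 - b) - 1) * k.+2%:R ^+ 2)).
    rewrite ler_wpM2r ?mulr_ge0 ?powR_ge0 ?exprn_ge0//.
    by rewrite -[leRHS]powRr1// ler_powR ?(ltW b1)// ler1n.
  by rewrite mulrA.
- by apply: is_cvg_seriesZ; apply: cvg_series_powR; rewrite subr_gt0.
Unshelve. all: by end_near. Qed.

End Growth.

(** * Convergence of the series defining the digamma function and the sums [F] *)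

Section Convergence.
Context {R : realType}.
Local Notation C := (Cplx R).

Lemma partial_sum1E (u : nat -> C) : partial_sum1 u = series (fun k => u k.+1).
Proof. by apply/funext => N; rewrite /partial_sum1 /series /= big_add1. Qed.

Variables (a : int -> C) (alpha : R).
Hypotheses (halpha : alpha < 1) (ha : is_littleo_pow a alpha).

Lemma weighted_series_cvg (n : nat) (f : nat -> C) (K : R) :
  (\forall k \near \oo, normR (f k) <= K / k.+2%:R ^+ 2) ->
  cvgn (series (fun k => a (k + n)%N%:Z * f k)).
Proof.
move=> fK; apply: (dominated_series_cvg
  (v := K *: (fun k => normR (a (k + n)%N%:Z) / k.+2%:R ^+ 2))); last first.
  by apply: is_cvg_seriesZ; exact: (littleo_pow_summable halpha ha).
apply: filterS fK => k fk; rewrite normRM.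
rewrite [leRHS](_ : _ = normR (a (k + n)%N%:Z) * (K / k.+2%:R ^+ 2)).
  by rewrite ler_wpM2l ?normR_ge0.
by rewrite mulrCA.
Qed.

(** [K] stays outside a sum independent of [f], so that it can later carry the geometric decay of
    the remainders. *)
Lemma weighted_series_norm (n : nat) (f : nat -> C) (K : R) :
  (forall k, normR (f k) <= K / k.+2%:R ^+ 2) ->
  normR (limn (series (fun k => a (k + n)%N%:Z * f k))) <=
  K * limn (series (fun k => normR (a (k + n)%N%:Z) / k.+2%:R ^+ 2)).
Proof.
move=> fK; have cW := @littleo_pow_summable _ _ _ halpha ha n.
have -> : K * limn (series (fun k => normR (a (k + n)%N%:Z) / k.+2%:R ^+ 2)) =
    limn (series (K *: (fun k => normR (a (k + n)%N%:Z) / k.+2%:R ^+ 2))).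
  by rewrite lim_seriesZ.
apply: dominated_series_norm; last exact: is_cvg_seriesZ.
move=> k; rewrite normRM.
rewrite [leRHS](_ : _ = normR (a (k + n)%N%:Z) * (K / k.+2%:R ^+ 2)).
  by rewrite ler_wpM2l ?normR_ge0.
by rewrite mulrCA.
Qed.

Lemma Psi_term_cvg (t : C) : (forall m : nat, t != m%:R) ->
  sum1_cvg (Psi_term a t).
Proof.
move=> ht; rewrite /sum1_cvg partial_sum1E.
rewrite (_ : (fun k => _) = fun k => a (k + 1)%N%:Z *
   (k.+1%:R^-1 - (k.+1%:R - t)^-1)); last first.
  by apply/funext => k; rewrite /Psi_term addn1; ring.
apply: (@weighted_series_cvg _ _ (4 * normR t)).
near=> k.
have k0 : k.+1%:R != 0 :> C by rewrite pnatr_eq0.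
have kt : k.+1%:R - t != 0 by rewrite subr_eq0 eq_sym.
(* Combining the two fractions gains the second inverse power of [k]. Once [k >= 2 |t|], both
   factors of the denominator are at least [(k+2) / 2] in norm, whence the constant 4. *)
rewrite (_ : _ - _ = - (t / (k.+1%:R * (k.+1%:R - t)))); last first.
  by field; rewrite nat1r kt.
rewrite normRN !normRM !normRV normRM normR_nat.
have kT : 2 * normR t <= k%:R.
  by near: k; exact: nbhs_infty_ger.
have h1 : k.+2%:R / 2 <= normR (k.+1%:R - t).
  have := ler_normRB k.+1%:R (- t); rewrite normRN normR_nat.
  have -> : k.+2%:R = k.+1%:R + 1 :> R by rewrite natr1.
  have -> : k.+1%:R = k%:R + 1 :> R by rewrite natr1.
  by lra.
have h2 : k.+2%:R / 2 <= k.+1%:R :> R.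
  rewrite ler_pdivrMr// -natrM ler_nat; lia.
rewrite [4 * _]mulrC -mulrA ler_wpM2l ?normR_ge0//.
have inv4 (x : R) : x != 0 -> 4 / x ^+ 2 = ((x / 2) * (x / 2))^-1.
  by move=> ?; field.
rewrite inv4 ?pnatr_eq0//.
have k2 : (0 : R) < k.+2%:R / 2 by rewrite divr_gt0.
rewrite lef_pV2 ?posrE ?mulr_gt0// ?normR_gt0//.
by rewrite ler_pM ?(ltW k2).
Unshelve. all: by end_near. Qed.

Variable n : nat.

Lemma F_term_S (j k : nat) : F_term a n j.+2 k.+1 =
  a (k + n.+1)%N%:Z * (k.+1%:R ^+ j.+2)^-1.
Proof. by rewrite /F_term /= -PoszD addnS addSn. Qed.

Lemma inv_expr_le (j k : nat) :
  normR ((k.+1%:R ^+ j.+2)^-1 : C) <= 4 / k.+2%:R ^+ 2.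
Proof.
rewrite normRV normRX normR_nat.
rewrite -[leLHS]div1r ler_pdivlMr ?exprn_gt0// mulrAC ler_pdivrMr ?exprn_gt0//.
rewrite mul1r (_ : 4 = 2 ^+ 2); last by rewrite -natrX.
apply: (@le_trans _ _ (2 ^+ 2 * k.+1%:R ^+ 2)).
  rewrite -exprMn lerXn2r ?nnegrE ?mulr_ge0// -natrM ler_nat; lia.
by rewrite ler_wpM2l ?exprn_ge0// ler_weXn2l// ler1n.
Qed.

(** A telescoping sum with gap [n]: the partial sum of rank [N] consists of the [n] terms from rank
    [N] on, each tending to 0, minus the first [n] terms. *)
Lemma div_shift_cvg (B := \sum_(1 <= k < n.+1) a k%:Z / k%:R) :
  series (fun k => a (k + n.+1)%N%:Z / (k + n.+1)%N%:R - a k.+1%:Z / k.+1%:R)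
    @ \oo --> - B.
Proof.
pose b k := a k.+1%:Z / k.+1%:R.
rewrite (_ : series _ = fun N => \sum_(i < n) b (N + i)%N - B); last first.
  apply/funext => N; rewrite /B big_add1 /= big_mkord.
  rewrite /series /= sumrB; apply/eqP; rewrite subr_eq addrAC -subr_eq opprK.
  apply/eqP.
  rewrite [X in _ + X](_ : _ = \sum_(0 <= i < n) b i); last by rewrite big_mkord.
  rewrite addrC -(big_mkord xpredT (fun i => b (N + i)%N)).
  transitivity (\sum_(0 <= i < n + N) b i).
    rewrite addrC [RHS](@big_cat_nat _ _ _ n)//= ?leq_addr//; congr (_ + _).
    rewrite [RHS](big_addn 0 _ n) addKn; apply: eq_bigr => i _.
    by rewrite /b addnS.
  rewrite addnC [LHS](@big_cat_nat _ _ _ N)//= ?leq_addr//; congr (_ + _).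
  rewrite [LHS](big_addn 0 _ N) addKn; apply: eq_bigr => i _.
  by rewrite addnC.
rewrite -[X in _ --> X]add0r; apply: cvgB; last exact: cvg_cst.
have bi (i : nat) : (fun N => b (N + i)%N) @ \oo --> (0 : C).
  have := littleo_pow_div_cvg0 halpha ha.
  rewrite -(cvg_shiftn i.+1 (fun k => a k%:Z / k%:R)).
  by under eq_fun do rewrite addnS.
elim: n => [|m IH].
  by under eq_cvg do rewrite big_ord0; exact: cvg_cst.
rewrite (_ : (fun N => _) = fun N => \sum_(i < m) b (N + i)%N + b (N + m)%N).
  by rewrite -[X in _ --> X]add0r; apply: cvgD; [exact: IH|exact: bi].
by apply/funext => N; rewrite big_ord_recr.
Qed.

Lemma F_term_cvg (j : nat) : (1 <= j)%N -> sum1_cvg (F_term a n j).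
Proof.
rewrite /sum1_cvg partial_sum1E; case: j => [//|[|j]] _; last first.
  rewrite (_ : (fun k => _) = fun k => a (k + n.+1)%N%:Z * (k.+1%:R ^+ j.+2)^-1).
    by apply: (@weighted_series_cvg _ _ 4); apply: nearW => k; exact: inv_expr_le.
  by apply/funext => k; exact: F_term_S.
(* Case [j = 1]: [(a_(k+n) - a_k) / k] splits into the telescoping difference
   [a_(k+n) / (k+n) - a_k / k] and [a_(k+n) (1/k - 1/(k+n))], whose weight is of order [1/k^2]. *)
rewrite (_ : (fun k => _) =
  (fun k => a (k + n.+1)%N%:Z / (k + n.+1)%N%:R - a k.+1%:Z / k.+1%:R) +
  (fun k => a (k + n.+1)%N%:Z * (k.+1%:R^-1 - (k + n.+1)%N%:R^-1))); last first.
  by apply/funext => k; rewrite /F_term /= -PoszD !fctE addnS addSn; ring.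
apply: is_cvg_seriesD; first by apply/cvg_ex; eexists; exact: div_shift_cvg.
apply: (@weighted_series_cvg _ _ (4 * n%:R)); apply: nearW => k.
rewrite (_ : _ - _ = n%:R / (k.+1%:R * (k + n.+1)%N%:R)); last first.
  have : (k.+1 + n)%N%:R != 0 :> C by rewrite pnatr_eq0.
  have : k.+1%:R != 0 :> C by rewrite pnatr_eq0.
  rewrite addnS -addSn natrD; move: (k.+1%:R : C) => x x0 y0; field.
  by rewrite y0.
rewrite normRM normRV normRM !normR_nat [4 * _]mulrC -mulrA ler_wpM2l//.
rewrite -[leLHS]div1r ler_pdivlMr ?exprn_gt0//.
rewrite mulrAC ler_pdivrMr ?mulr_gt0 ?ltr0n ?addnS//.
rewrite mul1r -natrX -!natrM ler_nat; nia.
Qed.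

End Convergence.

(** * Laurent expansion of the digamma function around the pole of index [n] *)

Section LaurentExpansion.
Context {R : realType}.
Local Notation C := (Cplx R).
Variables (a : int -> C) (alpha : R).
Hypotheses (halpha : alpha < 1) (ha : is_littleo_pow a alpha).
Variables (n : nat) (v : C).
Hypothesis hv : normR v < 1.

Lemma normR_natS_sub_ge (i : nat) : i.+1%:R * (1 - normR v) <= normR (i.+1%:R - v).
Proof.
have := ler_normRB i.+1%:R (- v); rewrite normRN normR_nat.
apply: le_trans; rewrite mulrBr mulr1 lerD2l lerN2.
by rewrite ler_peMl ?normR_ge0// ler1n.
Qed.

Lemma normR_natS_add_ge (i : nat) : i.+1%:R * (1 - normR v) <= normR (i.+1%:R + v).
Proof.
have := ler_normRB i.+1%:R v; rewrite normR_nat.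
apply: le_trans; rewrite mulrBr mulr1 lerD2l lerN2.
by rewrite ler_peMl ?normR_ge0// ler1n.
Qed.

Lemma natS_sub_neq0 (i : nat) : i.+1%:R - v != 0.
Proof.
rewrite -normR_gt0; apply: lt_le_trans (normR_natS_sub_ge i).
by rewrite mulr_gt0// subr_gt0.
Qed.

Lemma natS_add_neq0 (i : nat) : i.+1%:R + v != 0.
Proof.
rewrite -normR_gt0; apply: lt_le_trans (normR_natS_add_ge i).
by rewrite mulr_gt0// subr_gt0.
Qed.

(* Remainders after [J] (resp. [J.+1]) terms of the geometric expansions in [v]
   of [1 / (i - v)] and [1 / (i + v)], weighted by [a]; the shift of [J] above
   makes the series absolutely convergent. *)
Definition rem_below (J : nat) : C := \sum_(1 <= i < n.+1)
  a (n%:Z - i%:Z) * (v ^+ J / (i%:R ^+ J * (i%:R - v))).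

Definition rem_above_term (J k : nat) : C :=
  a (k + n.+1)%N%:Z * ((- v) ^+ J.+1 / (k.+1%:R ^+ J.+1 * (k.+1%:R + v))).

Definition rem_above (J : nat) : C := limn (series (rem_above_term J)).

(** One inverse power of [k+1] comes from the first factor and one from [k+1+v]; discarding the
    others gives a bound geometric in [J] and of order [1/k^2]. *)
Lemma rem_above_bound (J k : nat) :
  normR ((- v) ^+ J.+1 / (k.+1%:R ^+ J.+1 * (k.+1%:R + v))) <=
  (normR v ^+ J.+1 * (4 / (1 - normR v))) / k.+2%:R ^+ 2.
Proof.
have v0 : 0 < 1 - normR v by rewrite subr_gt0.
rewrite normRM normRV normRM !normRX normRN normR_nat -mulrA.
rewrite ler_wpM2l ?exprn_ge0 ?normR_ge0//.
have k2 : (0 : R) < k.+2%:R ^+ 2 by rewrite exprn_gt0.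
have kv : 0 < normR (k.+1%:R + v) by rewrite normR_gt0 natS_add_neq0.
have h1 : k.+1%:R <= k.+1%:R ^+ J.+1 :> R.
  by rewrite exprS ler_peMr// -natrX ler1n expn_gt0.
have h2 := normR_natS_add_ge k.
rewrite -[leLHS]div1r ler_pdivrMr ?mulr_gt0 ?exprn_gt0//.
rewrite mulrAC ler_pdivlMr// mul1r mulrAC ler_pdivlMr//.
apply: (@le_trans _ _ (4 * (k.+1%:R * (k.+1%:R * (1 - normR v))))); last first.
  by rewrite ler_wpM2l// ler_pM// mulr_ge0// ltW.
rewrite !mulrA ler_wpM2r ?(ltW v0)// -natrX -!natrM ler_nat; lia.
Qed.

Lemma rem_above_cvg (J : nat) : cvgn (series (rem_above_term J)).
Proof.
apply: (weighted_series_cvg halpha ha); apply: nearW => k.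
exact: rem_above_bound.
Qed.

Lemma rem_above_cvg0 : rem_above @ \oo --> (0 : C).
Proof.
have v1 : `|normR v| < 1 by rewrite ger0_norm ?normR_ge0.
pose T := limn (series (fun k => normR (a (k + n.+1)%N%:Z) / k.+2%:R ^+ 2)).
pose K := 4 / (1 - normR v) * T * normR v.
apply: (cvgC_squeeze (g := geometric K (normR v))); last exact: cvg_geometric.
apply: nearW => J; rewrite sub0r normRN.
have := @weighted_series_norm _ _ _ halpha ha n.+1 _ _ (rem_above_bound J).
rewrite -/T => /le_trans; apply; rewrite /K exprS /=.
by rewrite le_eqVlt; apply/orP; left; apply/eqP; ring.
Qed.

Lemma rem_below_cvg0 : rem_below @ \oo --> (0 : C).
Proof.
have v1 : `|normR v| < 1 by rewrite ger0_norm ?normR_ge0.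
have v0 : 0 < 1 - normR v by rewrite subr_gt0.
pose K := \sum_(1 <= i < n.+1) normR (a (n%:Z - i%:Z)) / (1 - normR v).
apply: (cvgC_squeeze (g := geometric K (normR v))); last exact: cvg_geometric.
apply: nearW => J; rewrite sub0r normRN.
apply: le_trans (ler_normR_sum _ _ _) _.
rewrite /K /= mulr_suml; apply: ler_sum_nat => -[//|i] _.
rewrite normRM -mulrA ler_wpM2l ?normR_ge0//.
rewrite normRM normRV normRX [leRHS]mulrC ler_wpM2l ?exprn_ge0 ?normR_ge0//.
rewrite lef_pV2 ?posrE//; last first.
  by rewrite normR_gt0 mulf_neq0 ?natS_sub_neq0// expf_neq0// pnatr_eq0.
rewrite normRM normRX normR_nat.
apply: (@le_trans _ _ (1 * (1 * (1 - normR v)))); first by rewrite !mul1r.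
rewrite ler_pM ?mul1r ?(ltW v0)//.
  by rewrite -natrX ler1n expn_gt0.
apply: le_trans (normR_natS_sub_ge i).
by rewrite ler_peMl ?(ltW v0)// ler1n.
Qed.

(** Termwise, this is [1/(i-v) = 1/i + v / (i (i-v))]. *)
Lemma rem_belowB (J : nat) : rem_below J - rem_below J.+1 = E a n J.+1 * v ^+ J.
Proof.
rewrite /rem_below /E -sumrB mulr_suml.
rewrite big_nat_cond [RHS]big_nat_cond; apply: eq_bigr => -[//|i] _.
have := natS_sub_neq0 i.
have : i.+1%:R != 0 :> C by rewrite pnatr_eq0.
move: (i.+1%:R : C) => x x0 xv; rewrite !exprS; field.
by rewrite xv x0 expf_neq0.
Qed.

Lemma F_cvg (j : nat) : (1 <= j)%N ->
  series (fun k => F_term a n j k.+1) @ \oo --> F a n j.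
Proof.
move=> j1; have := @F_term_cvg _ _ _ halpha ha n _ j1.
by rewrite /F /sum1 /sum1_cvg partial_sum1E.
Qed.

(** Termwise, this is [1/(x+v) = 1/x - v / (x (x+v))]. The shift in [rem_above] puts the index of
    [F] at 2 or more, where [F] carries no correction term. *)
Lemma rem_aboveB (J : nat) : rem_above J.+1 - rem_above J =
  (-1) ^+ J.+2 * F a n J.+2 * v ^+ J.+1.
Proof.
apply/eqP; rewrite subr_eq mulrAC; apply/eqP/limnC.
rewrite (_ : series _ = fun N => (-1) ^+ J.+2 * v ^+ J.+1 *
  series (fun k => F_term a n J.+2 k.+1) N + series (rem_above_term J) N).
  apply: cvgD; last exact: rem_above_cvg.
  by apply: cvgM; [exact: cvg_cst|exact: F_cvg].
apply/funext => N; rewrite /series /= mulr_sumr -big_split /=.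
apply: eq_bigr => k _; rewrite F_term_S /rem_above_term.
have := natS_add_neq0 k.
have : k.+1%:R != 0 :> C by rewrite pnatr_eq0.
rewrite [X in _ * (X / _)]exprNn [X in _ = _ + _ * (X / _)]exprNn.
move: (k.+1%:R : C) => x x0 xv; rewrite !exprS; field.
by rewrite xv x0 expf_neq0.
Qed.

Lemma psum_M_cvg :
  series (fun j => M a n j.+1 * v ^+ j) @ \oo --> rem_below 0 - F a n 1 - rem_above 0.
Proof.
(* The coefficient of index 0, which contains [F a n 1], is split off; each later term is a sum of
   two differences of consecutive remainders. *)
rewrite -cvg_shiftS.
rewrite (_ : [sequence _]_N = fun N => rem_below 0 - rem_below N.+1 - F a n 1
   + (rem_above N - rem_above 0)).
  rewrite (_ : _ - _ - _ = rem_below 0 - 0 - F a n 1 + (0 - rem_above 0));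
    last by rewrite subr0 sub0r.
  apply: cvgD; apply: cvgB; try exact: cvg_cst; last exact: rem_above_cvg0.
  apply: cvgB; first exact: cvg_cst.
  by rewrite cvg_shiftS; exact: rem_below_cvg0.
apply/funext => N /=; elim: N => [|N IH].
  rewrite /series /= big_nat1 subrr addr0 rem_belowB /M expr0 expr1.
  by ring.
rewrite seriesSr IH.
have -> : M a n N.+2 * v ^+ N.+1 = (rem_below N.+1 - rem_below N.+2)
    + (rem_above N.+1 - rem_above N).
  by rewrite rem_belowB rem_aboveB /M mulrDl.
by ring.
Qed.

(** Reversing the summation by [i = n - k] turns [k - s] into [v - i]: the index [i = 0] is the
    polar term and the others form the remainder at [J = 0]. *)
Lemma pole_sum_rev (s := n%:R - v) :
  a 0 / s - \sum_(1 <= k < n.+1) a k%:Z / (k%:R - s) =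
  - a n%:Z / v + rem_below 0.
Proof.
pose G (k : nat) := - (a k%:Z / (k%:R - s)).
transitivity (\sum_(0 <= k < n.+1) G k).
  rewrite [RHS]big_nat_recl// big_add1 /= -sumrN; congr (_ + _).
  by rewrite /G sub0r invrN mulrN opprK.
rewrite big_nat_rev /= [LHS]big_nat_recl// /rem_below big_add1 /=; congr (_ + _).
  rewrite /G add0n subn1 /= (_ : n%:R - s = v) ?mulNr//.
  by rewrite /s; ring.
apply: eq_big_nat => i /andP[_ iN].
rewrite /G add0n subSS -subzn// expr0 mul1r expr0 mul1r.
rewrite (_ : (n - i.+1)%N%:R - s = - (i.+1%:R - v)); last first.
  by rewrite natrB// /s; ring.
by rewrite invrN mulrN opprK.
Qed.

Lemma Psi_expansion (z : C) : z + n%:R = v ->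
  Psi a z = - a n%:Z / v + psum (fun j => M a n j.+1) v.
Proof.
move=> zv; rewrite /psum (limnC psum_M_cvg).
have sE : - z = n%:R - v by rewrite -zv opprD addrC addrNK.
rewrite /Psi sE; set s := n%:R - v.
pose B := \sum_(1 <= k < n.+1) a k%:Z / k%:R.
pose P := \sum_(1 <= k < n.+1) Psi_term a s k.
have -> : sum1 (Psi_term a s) = - B - F a n 1 - rem_above 0 + P.
  (* The indices up to [n] form [P]. Beyond them, with [k] counted from [n],
     [a_(k+n) / (k+n) - a_(k+n) / (k+v)] is the telescoping term [X], minus the term of [F a n 1],
     minus the remainder term at [J = 0]. *)
  apply: limnC; rewrite partial_sum1E -(cvg_shiftn n).
  pose X k := a (k + n.+1)%N%:Z / (k + n.+1)%N%:R - a k.+1%:Z / k.+1%:R.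
  rewrite (_ : [sequence _]_N = fun N => series X N
    - series (fun k => F_term a n 1 k.+1) N - series (rem_above_term 0) N + P).
    apply: cvgD; last exact: cvg_cst.
    apply: cvgB; last exact: rem_above_cvg.
    by apply: cvgB; [exact: (div_shift_cvg halpha ha)|exact: F_cvg].
  apply/funext => N /=.
  rewrite /series /= (@big_cat_nat _ _ _ n)//= ?leq_addl// addrC.
  rewrite [P]big_add1; congr (_ + _).
  rewrite (big_addn 0 _ n) addnK -!sumrB; apply: eq_bigr => k _.
  rewrite /Psi_term /X /F_term /rem_above_term /= -PoszD !addnS !addSn.
  rewrite !expr1.
  have -> : (k + n).+1%:R - s = k.+1%:R + v.
    by rewrite /s -addSn natrD; ring.
  have := natS_add_neq0 k.
  have : k.+1%:R != 0 :> C by rewrite pnatr_eq0.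
  have : (k + n).+1%:R != 0 :> C by rewrite pnatr_eq0.
  move: ((k + n).+1%:R : C) (k.+1%:R : C) => y x y0 x0 xv; field.
  by rewrite xv x0 y0.
rewrite (_ : P = B - \sum_(1 <= k < n.+1) a k%:Z / (k%:R - s)); last first.
  by rewrite /P /B -sumrB.
have := pole_sum_rev; rewrite -/s => /(canRL (subrK _)) ->.
by ring.
Qed.

End LaurentExpansion.

(** * Iterated derivatives of the Laurent expansion *)

Section Derivatives.
Context {R : realType}.
Local Notation C := (Cplx R).

Lemma iter_psum_diffs (q : nat) (c : nat -> C) (j : nat) :
  iter q psum_diffs c j = ((j + q) ^_ q)%:R * c (j + q)%N.
Proof.
elim: q j => [|q IH] j; first by rewrite addn0 mul1r.
rewrite iterS /psum_diffs IH mulrA -natrM addSnnS; congr (_%:R * _).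
by rewrite ffactnSr mulnC; congr (_ * _)%N; rewrite addnS subSn ?leq_addl// addnK.
Qed.

Lemma conv_disk_iter (q : nat) (c : nat -> C) :
  conv_disk c -> conv_disk (iter q psum_diffs c).
Proof. by move=> hc; elim: q => [//|q IH]; exact: conv_disk_diffs. Qed.

Lemma is_derive_pole (k b z : C) (q : nat) : z + b != 0 ->
  is_derive z 1 (fun x : C => k / (x + b) ^+ q.+1)
    (- (q.+1%:R * k) / (z + b) ^+ q.+2).
Proof.
move=> zb; pose f : C -> C := (fun x : C => x + b) ^+ q.+1.
have fE x : f x = (x + b) ^+ q.+1 by rewrite /f exprfctE.
have [df ef] : is_derive z (1 : C) f (q.+1%:R * (z + b) ^+ q).
  have h := is_deriveX q.+1 (is_derive_shift z (1 : C) b).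
  by apply: is_derive_eq h _; exact: mulr1.
have fz : f z != 0 by rewrite fE expf_neq0.
have h := is_deriveZ k (DeriveDef (derivableV fz df) (deriveV fz df)).
rewrite (_ : (fun x => _) = k \*: (fun y => (f y)^-1)); last first.
  by apply/funext => x; rewrite -fE.
apply: is_derive_eq h _; rewrite ef fE.
transitivity (k * (- ((z + b) ^+ q.+1) ^- 2 * (q.+1%:R * (z + b) ^+ q))) => //.
rewrite !exprS; field.
by rewrite zb expf_neq0.
Qed.

Variables (a : int -> C) (alpha : R).
Hypotheses (halpha : alpha < 1) (ha : is_littleo_pow a alpha).
Variable n : nat.

Lemma conv_disk_M : conv_disk (fun j => M a n j.+1).
Proof.
move=> w; rewrite normR_lt1 => w1; apply/cvg_ex; eexists.
exact: (psum_M_cvg halpha ha).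
Qed.

(** The [q]-th derivative of the Laurent expansion, with polar and regular parts differentiated
    separately. *)
Definition Psi_derive (q : nat) (z : C) : C :=
  - ((-1) ^+ q * q`!%:R * a n%:Z) / (z + n%:R) ^+ q.+1
  + psum (iter q psum_diffs (fun j => M a n j.+1)) (z + n%:R).

Lemma is_derive_Psi_derive (q : nat) (z : C) : `|z + n%:R| < 1 ->
  z + n%:R != 0 -> is_derive z 1 (Psi_derive q) (Psi_derive q.+1 z).
Proof.
move=> z1 z0.
have h1 := is_derive_pole (- ((-1) ^+ q * q`!%:R * a n%:Z)) q z0.
have h2 := is_derive_psum (conv_disk_iter (q := q) conv_disk_M) z1.
apply: is_derive_eq (is_deriveD h1 h2) _.
rewrite /Psi_derive; congr (_ / _ + _).
by rewrite factS natrM exprS; ring.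
Qed.

Lemma punctured_disk_near (z : C) : `|z + n%:R| < 1 -> z + n%:R != 0 ->
  \forall x \near z, `|x + n%:R| < 1 /\ x + n%:R != 0.
Proof.
rewrite normR_lt1 => z1; rewrite -normR_gt0 => z0.
(* The distance from [z] to the centre of the punctured disk or to its boundary circle, whichever is
   smaller. *)
pose e := Num.min (normR (z + n%:R)) (1 - normR (z + n%:R)).
have e0 : 0 < e by rewrite lt_min z0 subr_gt0.
have e0' : (0 : C) < e%:C%C by apply: (etrans (ltcR _ _)).
have := nbhsx_ballx z _ e0'.
apply: filterS => x; rewrite -ball_normE /= normR_lt normR_lt1 -normR_gt0.
rewrite lt_min => /andP[h1 h2].
have E : z + n%:R = (z - x) + (x + n%:R) by ring.
have := ler_normRD (z - x) (x + n%:R); rewrite -E => h3.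
have := ler_normRD (- (z - x)) (z + n%:R); rewrite normRN.
have -> : - (z - x) + (z + n%:R) = x + n%:R by ring.
move=> h4; split; lra.
Qed.

Lemma derive1n_Psi (q : nat) (z : C) : `|z + n%:R| < 1 -> z + n%:R != 0 ->
  derive1n q (Psi a) z = Psi_derive q z /\
  is_derive z 1 (derive1n q (Psi a)) (Psi_derive q.+1 z).
Proof.
(* A derivative depends on values near the point, so the closed form is assumed on the whole open
   punctured disk and transferred by local equality. *)
have step q' : (forall x : C, `|x + n%:R| < 1 -> x + n%:R != 0 ->
    derive1n q' (Psi a) x = Psi_derive q' x) ->
    forall x : C, `|x + n%:R| < 1 -> x + n%:R != 0 ->
    is_derive x 1 (derive1n q' (Psi a)) (Psi_derive q'.+1 x).
  move=> h x x1 x0; apply: near_eq_is_derive (is_derive_Psi_derive _ x1 x0).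
  have := punctured_disk_near x1 x0.
  by apply: filterS => y [y1 y0]; rewrite h.
have main q' : forall x : C, `|x + n%:R| < 1 -> x + n%:R != 0 ->
    derive1n q' (Psi a) x = Psi_derive q' x.
  elim: q' => [|q' IH] x x1 x0.
    rewrite derive1n0 /Psi_derive mul1r mul1r expr1.
    by apply: (Psi_expansion halpha ha) => //; rewrite -normR_lt1.
  by rewrite derive1nS derive1E; have [_ ->] := step _ IH _ x1 x0.
by move=> z1 z0; split; [exact: main|exact: step (main q) _ _ _].
Qed.

End Derivatives.

(** * Identification of the derived expansion with the binomial form *)

Theorem theorem2p1 (R : realType) (a : int -> Cplx R)
  (alpha : R) (halpha : alpha < 1) (ha : is_littleo_pow a alpha)
  (p n : nat) (hp : (1 <= p)%N) (s : Cplx R)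
  (hs : `|s - n%:R| < 1) (hsn : s != n%:R) :
  let expansion_term (j : nat) : Cplx R :=
    (-1) ^+ j * 'C(j + p - 2, p - 1)%:R * M a n (j + p - 1)
      * (s - n%:R) ^+ (j + p - 1) in
  (* the objects in the formula are well defined ... *)
  [/\ (forall t : Cplx R, (forall m : nat, t != m%:R) ->
         sum1_cvg (Psi_term a t)),
      (forall j : nat, (1 <= j)%N -> sum1_cvg (F_term a n j)),
      (forall i : nat, (i < p - 1)%N ->
         derivable (derive1n i (Psi a)) (- s) (1 : Cplx R)),
      sum1_cvg expansion_term
  (* ... and the formula holds *)
    & derive1n (p - 1) (Psi a) (- s) / ((p - 1)`!)%:R =
        1 / (s - n%:R) ^+ p * (a n%:Z - sum1 expansion_term)].
Proof.
case: p hp => [//|q] _ expansion_term.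
have sv : - s + n%:R = - (s - n%:R) by rewrite opprB addrC.
have v1 : `|- s + n%:R| < 1 by rewrite sv normrN.
have v0 : - s + n%:R != 0 by rewrite sv oppr_eq0 subr_eq0.
have [dE _] := derive1n_Psi halpha ha q v1 v0.
have cM := conv_disk_iter (q := q) (@conv_disk_M _ _ _ halpha ha n) v1.
have fq : q`!%:R != 0 :> Cplx R by rewrite pnatr_eq0 -lt0n fact_gt0.
set v := - s + n%:R in v1 v0 cM.
(* With [p = q + 1] and [s - n = - v], the signs depending on [j] square to 1, and the binomial is
   the falling factorial of [iter_psum_diffs] over [q!]. Only a factor independent of [j]
   remains. *)
have tE : (fun j => expansion_term j.+1) = ((-1) ^+ q * v ^+ q.+1 / q`!%:R) *:
    (fun j => iter q psum_diffs (fun j => M a n j.+1) j * v ^+ j).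
  apply/funext => j; transitivity ((-1) ^+ q * v ^+ q.+1 / q`!%:R *
    (iter q psum_diffs (fun j => M a n j.+1) j * v ^+ j)); last by [].
  rewrite /expansion_term iter_psum_diffs.
  rewrite (_ : (j.+1 + q.+1 - 2)%N = (j + q)%N); last by lia.
  rewrite (_ : (j.+1 + q.+1 - 1)%N = (j + q).+1%N); last by lia.
  rewrite subn1 /= -bin_ffact natrM.
  rewrite (_ : s - n%:R = - v); last by rewrite /v opprD opprK.
  rewrite [(- v) ^+ _]exprNn !exprS !exprD.
  have := sqrr_sign (Cplx R) j; rewrite expr2.
  move: ((-1) ^+ j : Cplx R) => e ee.
  transitivity (e * e * ((-1) ^+ q * v * v ^+ q * v ^+ j * 'C(j + q, q)%:R *
    M a n (j + q).+1)); first by ring.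
  by rewrite ee; field.
split.
- exact: Psi_term_cvg halpha ha.
- exact: F_term_cvg halpha ha n.
- by move=> i _; have [_ []] := derive1n_Psi halpha ha i v1 v0.
- by rewrite /sum1_cvg partial_sum1E tE; apply: is_cvg_seriesZ.
rewrite subn1 /= dE /Psi_derive -/v.
rewrite /sum1 partial_sum1E tE lim_seriesZ// -/(psum _ _).
rewrite (_ : s - n%:R = - v); last by rewrite /v opprD opprK.
rewrite [(- v) ^+ _]exprNn.
have := sqrr_sign (Cplx R) q; rewrite expr2 !exprS.
move: (psum _ _) ((-1) ^+ q : Cplx R) => S e ee.
have e0 : e != 0 by apply/eqP => e0; move/eqP: ee; rewrite e0 mulr0 eq_sym oner_eq0.
have -> : (a n - (e * (v * v ^+ q) / q`!%:R) *: S) = a n - e * (v * v ^+ q) / q`!%:R * S.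
  by [].
(* The polar part carries the sign [e] in its numerator, whereas [(s - n)^p] puts it in the
   denominator; the two agree as [e] squares to 1. *)
have einv : e^-1 = e by apply: (mulfI e0); rewrite divff.
rewrite -{1}einv; field.
by rewrite e0 v0 fq expf_neq0.
Qed.
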